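(* Let $\mathcal{A}$ be a finite set with $k\geq 2$ elements and $\Sigma=\mathcal{A}^{\mathbb{Z}}$. Let $\varphi:\mathbb{N}_0\to[0,\infty)$ be a non-decreasing unbounded function such that there exists $c\in(1,k)$ satisfying $$k-\lfloor\varphi(0)\rfloor-\sum_{l=1}^{\infty}\frac{\lfloor\varphi(l)\rfloor-\lfloor\varphi(l-1)\rfloor}{c^l}\geq c,$$ where $\lfloor\cdot\rfloor$ denotes the integer part. Then there exists a $\varphi$-aperiodic word in $\Sigma$.
   Context: $\mathbb{N}_0$ denotes the natural numbers including $0$, $\mathbb{N}=\mathbb{N}_0\setminus\{0\}$. Elements $w:\mathbb{Z}\to\mathcal{A}$ of $\Sigma$ are called words, and $[w(i)\ldots w(i+l)]$ denotes the subword consisting of the $l+1$ letters at positions $i,\ldots,i+l$. For a non-decreasing function $\varphi:\mathbb{N}_0\to[0,\infty)$, a word $w\in\Sigma$ is called $\varphi$-aperiodic if for every $i\in\mathbb{Z}$ and every $l\in\mathbb{N}_0$, whenever $[w(i)\ldots w(i+l)]=[w(i+s)\ldots w(i+s+l)]$ for some $s\in\mathbb{N}$, then $s>\varphi(l)$. *)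

(* Defs.v *)
From HB Require Import structures.
From mathcomp Require Import all_boot all_order all_algebra.
From mathcomp Require Import all_classical all_reals all_analysis.

Set Implicit Arguments.
Unset Strict Implicit.
Unset Printing Implicit Defensive.

Import Order.TTheory GRing.Theory Num.Theory.

Local Open Scope ring_scope.

(* [w(i) ... w(i+l)]: l.+1 letters, not l. *)
Definition subword (A : Type) (w : int -> A) (i : int) (l : nat) : seq A :=
  mkseq (fun j : nat => w (i + j%:Z)) l.+1.

Definition aperiodic_word (R : realType) (A : Type) (phi : nat -> R)
    (w : int -> A) : Prop :=
  forall (i : int) (l s : nat), (0 < s)%N ->
    subword w i l = subword w (i + s%:Z) l -> phi l < s%:R.

(* Main.v *)
(** Counting argument.  Let [b n] be the number of [phi]-aperiodic words of
    length [n].  A one-letter extension of an aperiodic word can only fail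
    because its extremal factor of length [l + 1] recurs at some shift [s] with
    [s <= phi l], where [l] may be taken minimal for [s]; such a word is
    determined by its remaining [n - l] letters.  Hence
    [k * b n <= b (n + 1) + \sum_(l <= n) (p l - p (l - 1)) * b (n - l)] with [p] the
    integer part of [phi] and [p (-1) = 0], and induction yields
    [c * b n <= b (n + 1)].  So there are aperiodic words of every length,
    and a limit of them along an ultrafilter is the required
    bi-infinite word. *)
Require Import Defs.
From HB Require Import structures.
From mathcomp Require Import all_boot all_order all_algebra.
From mathcomp Require Import all_classical all_reals all_analysis.
From mathcomp Require Import zify lra.

Set Implicit Arguments.
Unset Strict Implicit.
Unset Printing Implicit Defensive.

Import Order.TTheory GRing.Theory Num.Theory.

Local Open Scope ring_scope.

Definition recurs (A : Type) (x0 : A) (t : seq A) (i l s : nat) : Prop :=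
  forall j, (j <= l)%N -> nth x0 t (i + j) = nth x0 t (i + s + j).

Definition aperiodic_seq (A : Type) (x0 : A) (p : nat -> nat) (t : seq A) : Prop :=
  forall i l s, (0 < s)%N -> (i + s + l < size t)%N -> recurs x0 t i l s ->
    (p l < s)%N.

Definition aperiodic_tuples (A : finType) (x0 : A) (p : nat -> nat) (n : nat) :
    {set n.-tuple A} :=
  [set t : n.-tuple A | `[< aperiodic_seq x0 p t >]].

(* The convention [p (-1) = 0]. *)
Definition incr (p : nat -> nat) (l : nat) : nat :=
  (p l - (if l is m.+1 then p m else 0))%N.

Lemma aperiodic_drop (A : Type) (x0 : A) (p : nat -> nat) (t : seq A) (m : nat) :
  aperiodic_seq x0 p t -> aperiodic_seq x0 p (drop m t).
Proof.
move=> ht i l s s0; rewrite size_drop => hlt hrec.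
apply: (ht (m + i)%N) => //; first by lia.
move=> j jl; have := hrec j jl; rewrite !nth_drop.
by rewrite !addnA.
Qed.

(** A recurrence not starting at the head lies in [u]. If the prefix of length [l + 1] recurs at a
    shift [s <= p l], so does the shorter one for the least [m] with [s <= p m]; hence only pairs
    with [p (l - 1) < s <= p l] need testing. *)
Lemma aperiodic_cons (A : Type) (x0 : A) (p : nat -> nat) (a : A) (u : seq A) :
    {homo p : m n / (m <= n)%N} -> aperiodic_seq x0 p u ->
  (forall l s, (0 < s)%N -> (s + l <= size u)%N ->
     (if l is m.+1 then p m < s else true)%N -> recurs x0 (a :: u) 0 l s ->
     (p l < s)%N) ->
  aperiodic_seq x0 p (a :: u).
Proof.
move=> pmono hu hmin [|i] l s s0 hsz hrec; last first.
  by apply: (hu i) => // j jl; exact: hrec j jl.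
rewrite ltnNge; apply/negP => spl.
have exl : exists l', (s <= p l')%N by exists l.
case: (ex_minnP exl) => m spm mmin.
have ml : (m <= l)%N by exact: mmin.
suff : (p m < s)%N by rewrite ltnNge spm.
apply: hmin => //.
- by move: hsz => /=; lia.
- case: m spm mmin ml => // m _ mmin _.
  by rewrite ltnNge; apply/negP => /mmin; rewrite ltnn.
- by move=> j jm; apply: hrec; apply: leq_trans ml.
Qed.

(* Reading from position [l] down to [0], each letter [t j] is copied from
   [t (j + s)], which is already known. *)
Lemma recurs_drop_inj (A : Type) (x0 : A) (t u : seq A) (l s : nat) :
    (0 < s)%N -> size t = size u ->
    recurs x0 t 0 l s -> recurs x0 u 0 l s ->
  drop l.+1 t = drop l.+1 u -> t = u.
Proof.
move=> s0 htu ht hu hd; apply: (@eq_from_nth _ x0) => // i _.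
have [m] := ubnP (l.+1 - i)%N; elim: m i => // m IH i him.
have [il|li] := leqP i l.
  rewrite -(add0n i) ht // hu // add0n IH //; lia.
by rewrite -(subnKC li) -!nth_drop hd.
Qed.

(** No bound keeps [s + l] within the tuple: reads past the end return [x0], and the letters from
    [l + 1] on still determine the rest. *)
Definition recurring_extensions (A : finType) (x0 : A) (p : nat -> nat)
    (n l s : nat) : {set n.+1.-tuple A} :=
  [set t : n.+1.-tuple A |
     `[< aperiodic_seq x0 p (behead t) /\ recurs x0 t 0 l s >]].

Lemma card_recurring_extensions (A : finType) (x0 : A) (p : nat -> nat)
    (n l s : nat) : (0 < s)%N ->
  (#|recurring_extensions x0 p n l s| <= #|aperiodic_tuples x0 p (n - l)|)%N.
Proof.
move=> s0.
pose f (t : n.+1.-tuple A) : (n - l).-tuple A := [tuple of drop l.+1 t].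
have finj : {in recurring_extensions x0 p n l s &, injective f}.
  move=> t u; rewrite !inE => -[_ ht] [_ hu] /(congr1 val) /= e.
  by apply/val_inj/(recurs_drop_inj s0 _ ht hu e); rewrite !size_tuple.
rewrite -(card_in_imset finj); apply: subset_leq_card.
apply/fintype.subsetP => _ /imsetP[t + ->]; rewrite !inE => -[ht _].
(* [drop l.+1 t] is a suffix of [behead t], hence aperiodic. *)
rewrite /= -drop1 in ht *.
by rewrite -(addn1 l) -drop_drop; exact: aperiodic_drop.
Qed.

Lemma leq_card_bigcup (T : finType) (n : nat) (F : 'I_n -> {set T}) :
  (#|\bigcup_(i < n) F i| <= \sum_(i < n) #|F i|)%N.
Proof.
elim/big_ind2 : _ => [|m X m' Y hm hm'|//]; first by rewrite cards0.
by apply: leq_trans (leq_card_setU _ _) _; exact: leq_add.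
Qed.

Lemma card_aperiodic_rec (A : finType) (x0 : A) (p : nat -> nat) (n : nat) :
    {homo p : m n / (m <= n)%N} ->
  (#|A| * #|aperiodic_tuples x0 p n| <=
    #|aperiodic_tuples x0 p n.+1| +
    \sum_(l < n.+1) incr p l * #|aperiodic_tuples x0 p (n - l)|)%N.
Proof.
move=> pmono.
pose g (x : A * n.-tuple A) : n.+1.-tuple A := [tuple of x.1 :: x.2].
have ginj : injective g.
  move=> [a t] [b u] /(congr1 val) /= [-> e].
  by congr pair; exact: val_inj.
(* As [j] runs below [incr p l], [shift l j] runs through the [s] with [p (l - 1) < s <= p l]. *)
pose shift (l j : nat) := (if l is m.+1 then p m + j.+1 else j.+1)%N.
have shift0 l j : (0 < shift l j)%N by case: l => [|l] /=; lia.
pose bad := \bigcup_(l < n.+1) \bigcup_(j < incr p l)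
  recurring_extensions x0 p n l (shift l j).
have -> : (#|A| * #|aperiodic_tuples x0 p n| =
    #|g @: finset.setX finset.setT (aperiodic_tuples x0 p n)|)%N.
  by rewrite card_imset // cardsX cardsT.
apply: (@leq_trans #|aperiodic_tuples x0 p n.+1 :|: bad|).
  apply: subset_leq_card; apply/fintype.subsetP => _ /imsetP[[a u] + ->].
  rewrite !inE /= => hu; apply/orP.
  have [hv|hna] := pselect (aperiodic_seq x0 p (a :: u)); [left|right].
    exact/asboolP.
  apply/bigcupP.
  apply: contrapT => hno; apply: hna; apply: aperiodic_cons => // l s s0.
  rewrite size_tuple => sln hl hrec; rewrite ltnNge; apply/negP => spl.
  apply: hno; have ln : (l < n.+1)%N by lia.
  exists (Ordinal ln) => //=; apply/bigcupP.
  pose j := (s - shift l 0)%N.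
  have sE : s = shift l j by rewrite /j; case: l {sln hrec spl ln j} hl => /=; lia.
  have jlt : (j < incr p l)%N.
    by rewrite /j /incr; case: l {sln hrec ln j sE} hl spl => /=; lia.
  exists (Ordinal jlt) => //=; rewrite inE; apply/asboolP; split => //=.
  by rewrite -sE.
apply: leq_trans (leq_card_setU _ _) _; rewrite leq_add2l.
apply: leq_trans (leq_card_bigcup _) _; apply: leq_sum => l _.
apply: leq_trans (leq_card_bigcup _) _.
rewrite -[X in (_ <= X * _)%N]card_ord -sum_nat_const; apply: leq_sum => j _.
exact: card_recurring_extensions.
Qed.

(** Growth at all earlier indices gives [b (n - l) <= b n / c ^+ l], so the subtracted sum is at
    most [(k - c) * b n], leaving [c * b n]. *)
Lemma growth_of_recursion (R : realFieldType) (k c : R) (b d : nat -> R) :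
    0 < c -> (forall n, 0 <= b n) -> (forall n, 0 <= d n) ->
    (forall n, \sum_(l < n.+1) d l / c ^+ l <= k - c) ->
    (forall n, k * b n <= b n.+1 + \sum_(l < n.+1) d l * b (n - l)%N) ->
  forall n, c * b n <= b n.+1.
Proof.
move=> c0 b0 d0 hd hb; elim/ltn_ind => n IH.
have hpow l : (l <= n)%N -> c ^+ l * b (n - l)%N <= b n.
  elim: l => [|l IHl] ln; first by rewrite expr0 mul1r subn0.
  apply: le_trans (IHl (ltnW ln)); rewrite exprSr -mulrA.
  apply: ler_wpM2l; first by rewrite exprn_ge0 // ltW.
  have -> : (n - l = (n - l.+1).+1)%N by lia.
  by apply: IH; lia.
have hs : \sum_(l < n.+1) d l * b (n - l)%N <= (k - c) * b n.
  apply: (@le_trans _ _ ((\sum_(l < n.+1) d l / c ^+ l) * b n)).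
    rewrite mulr_suml; apply: ler_sum => l _.
    rewrite -mulrA ler_wpM2l // mulrC ler_pdivlMr ?exprn_gt0 // mulrC.
    by apply: hpow; rewrite -ltnS.
  by rewrite ler_wpM2r.
by have := hb n; rewrite mulrBl in hs; lra.
Qed.

Lemma exists_aperiodic_seq (R : realFieldType) (A : finType) (x0 : A)
    (p : nat -> nat) (c : R) :
    {homo p : m n / (m <= n)%N} -> 0 < c ->
    (forall n, \sum_(l < n.+1) (incr p l)%:R / c ^+ l <= #|A|%:R - c) ->
  forall n, exists2 u : seq A, size u = n & aperiodic_seq x0 p u.
Proof.
move=> pmono c0 hd n.
pose b m : R := #|aperiodic_tuples x0 p m|%:R.
have grow : forall m, c * b m <= b m.+1.
  apply: (@growth_of_recursion _ #|A|%:R c b (fun l => (incr p l)%:R)) => // m.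
  have := card_aperiodic_rec x0 m pmono.
  rewrite -(ler_nat R) natrM natrD natr_sum.
  by under eq_bigr do rewrite natrM.
have bpos : forall m, 0 < b m.
  elim=> [|m IH]; last by apply: lt_le_trans (grow m); exact: mulr_gt0.
  rewrite ltr0n; apply/card_gt0P; exists [tuple]; rewrite inE.
  by apply/asboolP => i l s.
move: (bpos n); rewrite ltr0n => /card_gt0P[t]; rewrite inE => /asboolP ht.
by exists t => //; exact: size_tuple.
Qed.

(** Otherwise the ultrafilter contains the complements of all the fibres of [f]; these are finitely
    many, with empty intersection. *)
Lemma ultrafilter_limit (T : Type) (A : finType) (U : set_system T) (f : T -> A) :
  UltraFilter U -> exists a, \forall n \near U, f n = a.
Proof.
move=> UU; apply: contrapT => hno.
have : \forall n \near U, forall a, f n <> a.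
  apply: filter_forall => a.
  have [h|//] := in_ultra_setVsetC [set n | f n = a]%classic UU.
  by exfalso; apply: hno; exists a.
by move=> /filter_ex[n /(_ (f n))].
Qed.

Lemma aperiodic_word_of_seqs (A : finType) (x0 : A) (p : nat -> nat) :
    (forall n, exists2 u : seq A, size u = n & aperiodic_seq x0 p u) ->
  exists w : int -> A, forall (i : int) (l s : nat), (0 < s)%N ->
    subword w i l = subword w (i + s%:Z) l -> (p l < s)%N.
Proof.
move=> hu.
have /boolp.choice[u hu2] n : exists v : seq A,
    size v = (n + n)%N /\ aperiodic_seq x0 p v.
  by have [v] := hu (n + n)%N; exists v.
have [U [UU Uoo]] := ultraFilterLemma (F := eventually) _.
(* The word [u n] of length [2n] is centred at the origin; the absolute value and the default [x0]
   can matter only when [n <= |i|]. *)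
pose f (i : int) (n : nat) := nth x0 (u n) `|(i + n%:Z)%R|%N.
have /boolp.choice[w hw] i : exists a, \forall n \near U, f i n = a.
  exact: ultrafilter_limit.
exists w => i l s s0 hrec.
have hbig : \forall n \near U, (`|i|%N + s + l < n)%N.
  by apply: Uoo; exact: nbhs_infty_gt.
(* Only the finitely many positions from [i] to [i + s + l] are involved, so a single [n] serves
   them all. *)
have hagree : \forall n \near U, forall j : 'I_(s + l).+1,
    f (i + j%:Z) n = w (i + j%:Z).
  by apply: filter_forall => j; exact: hw.
have [n [nbig agree]] := filter_ex (filterI hbig hagree).
have {}agree j : (j <= s + l)%N -> f (i + j%:Z) n = w (i + j%:Z).
  by move=> hj; exact: (agree (Ordinal (hj : (j < (s + l).+1)%N))).
have [usz uap] := hu2 n.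
apply: (uap `|(i + n%:Z)%R|%N) => //; first by rewrite usz; lia.
move=> j jl.
have := congr1 (fun v => nth x0 v j) hrec.
rewrite !nth_mkseq // -addrA -PoszD -!agree; [|lia..].
rewrite /f => e; have -> : (`|(i + n%:Z)%R| + j = `|(i + j%:Z + n%:Z)%R|)%N by lia.
by rewrite e; congr nth; lia.
Qed.

Theorem theorem3p3 (R : realType) (A : finType) (k : nat)
    (cardA : #|A| = k) (k_ge2 : (2 <= k)%N)
    (phi : nat -> R)
    (phi_ge0 : forall l : nat, 0 <= phi l)
    (phi_nondecreasing : forall m n : nat, (m <= n)%N -> phi m <= phi n)
    (phi_unbounded : forall M : R, exists n : nat, M < phi n)
    (hc : exists c : R, [/\ 1 < c, c < k%:R &
      (c%:E <= (k%:R - (Num.floor (phi 0%N))%:~R)%:E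
               - \sum_(1 <= l <oo)
                   (((Num.floor (phi l))%:~R - (Num.floor (phi l.-1))%:~R)
                      / c ^+ l)%:E)%E]) :
  exists w : int -> A, aperiodic_word phi w.
Proof.
case: hc => c [c1 _ hsum].
have c0 : 0 < c by exact: lt_trans c1.
have [x0 _] : exists x0 : A, x0 \in A by apply/card_gt0P; rewrite cardA; lia.
pose p l := `|Num.floor (phi l)|%N.
have pE l : (p l)%:Z = Num.floor (phi l) by rewrite gez0_abs ?floor_ge0.
have pER l : (Num.floor (phi l))%:~R = (p l)%:R :> R by rewrite -pE.
have pmono : {homo p : m n / (m <= n)%N}.
  by move=> m n mn; rewrite -lez_nat !pE; apply: le_floor; exact: phi_nondecreasing.
have incrE l : (p l.+1)%:R - (p l)%:R = (incr p l.+1)%:R :> R.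
  by rewrite natrB // pmono.
have [|w hw] := @aperiodic_word_of_seqs A x0 p _.
  apply: (exists_aperiodic_seq x0 pmono c0) => n; rewrite cardA.
  have term_ge0 l : (1 <= l)%N -> (0 <= (((Num.floor (phi l))%:~R -
      (Num.floor (phi l.-1))%:~R) / c ^+ l)%:E)%E.
    case: l => // l _; rewrite lee_fin !pER incrE.
    by rewrite divr_ge0 // exprn_ge0 // ltW.
  (* The terms are nonnegative, so each partial sum is at most the series; this leaves a real
     inequality for every [n]. *)
  have := le_trans hsum (leeB (lexx _)
    (@nneseries_lim_ge R _ xpredT 1 n.+1 (fun l l1 _ => term_ge0 l l1))).
  rewrite sumEFin -EFinB lee_fin big_add1 big_mkord.
  (* The summand [l = 0] is [p 0], the integer part of [phi 0] that stands outside the series. *)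
  rewrite big_ord_recl expr0 divr1 pER /incr subn0.
  under eq_bigr do rewrite !pER incrE.
  by rewrite /bump /=; lra.
exists w => i l s s0 /(hw i l s s0) pls.
(* Since [s] is an integer, bounding the floor of [phi l] strictly by [s] bounds [phi l] itself. *)
by rewrite -[s%:R]/(s%:Z%:~R) -floor_lt_int -pE ltz_nat.
Qed.
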